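(* Let $\alpha>0$, $\lambda>0$, let $X_1,X_2$ be a random sample of size $n=2$ from the gamma distribution $G(\lambda,\alpha)$, and let $\hat\alpha=\bar X^2/S^2$ be the moment estimator of $\alpha$. Then $1/\hat\alpha$ has the beta distribution with parameters $1/2$ and $\alpha$. Hence $\hat\alpha$ has monotone likelihood ratio: the family of distributions of $\hat\alpha$ indexed by $\alpha>0$ has monotone likelihood ratio.
   Context: $G(\lambda,\alpha)$ denotes the gamma distribution with shape parameter $\alpha>0$ and scale parameter $\lambda>0$, i.e. with density $f(x;\alpha,\lambda)=\frac{1}{\Gamma(\alpha)\lambda^{\alpha}}x^{\alpha-1}e^{-x/\lambda}$, $x>0$. A random sample is a collection of independent identically distributed random variables. For a sample $X_1,\dots,X_n$, $\bar X=\frac1n\sum_{i=1}^n X_i$ is the sample mean and $S^2=\frac1n\sum_{i=1}^n (X_i-\bar X)^2$ is the biased sample variance. The beta distribution with parameters $a,b>0$ has density $x^{a-1}(1-x)^{b-1}/B(a,b)$ on $(0,1)$, where $B$ is the beta function. A statistic whose density is $f^{\alpha}$ under parameter $\alpha$ has monotone likelihood ratio if for all $\alpha_1<\alpha_2$ the ratio $f^{\alpha_2}(x)/f^{\alpha_1}(x)$ is nondecreasing in $x$ on the common support. *)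

(* Defs.v *)
From HB Require Import structures.
From mathcomp Require Import all_boot all_order all_algebra.
From mathcomp Require Import all_classical all_reals all_analysis measurable_realfun.

Set Implicit Arguments.
Unset Strict Implicit.
Unset Printing Implicit Defensive.

Import Order.TTheory GRing.Theory Num.Theory.
Import numFieldNormedType.Exports.

Local Open Scope classical_set_scope.
Local Open Scope ring_scope.

Section densities.
Context {R : realType}.

Definition has_density (nu : set R -> \bar R) (f : R -> R) : Prop :=
  [/\ measurable_fun [set: R] f,
      (forall x, 0 <= f x) &
      (forall A, measurable A ->
        nu A = (\int[lebesgue_measure]_(x in A) (f x)%:E)%E)].

Definition gamma_function (a : R) : R :=
  \int[lebesgue_measure]_(x in `]0, +oo[) (x `^ (a - 1) * expR (- x)).

Definition gamma_density (lambda alpha x : R) : R :=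
  if 0 < x then
    (gamma_function alpha * lambda `^ alpha)^-1
      * x `^ (alpha - 1) * expR (- (x / lambda))
  else 0.

(* The library's beta_fun and beta_pdf only allow parameters in nat. *)
Definition beta_function (a b : R) : R :=
  \int[lebesgue_measure]_(x in `]0, 1[) (x `^ (a - 1) * (1 - x) `^ (b - 1)).

Definition beta_density (a b x : R) : R :=
  if 0 < x < 1 then x `^ (a - 1) * (1 - x) `^ (b - 1) / beta_function a b
  else 0.

(* Densities are only determined almost everywhere, hence the existential
   choice of versions f; D is the common support, on which every f theta
   is positive, so the likelihood ratio never has denominator 0 there. *)
Definition monotone_likelihood_ratio (Theta : set R)
    (nu : R -> set R -> \bar R) : Prop :=
  exists (f : R -> R -> R) (D : set R),
    [/\ (forall theta, Theta theta -> has_density (nu theta) (f theta)),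
        (forall theta, Theta theta -> [set x | 0 < f theta x] = D) &
        (forall theta1 theta2, Theta theta1 -> Theta theta2 ->
           theta1 < theta2 ->
           forall x y, D x -> D y -> x <= y ->
             f theta2 x / f theta1 x <= f theta2 y / f theta1 y)].

End densities.

Section samples.
Context {d : measure_display} {T : measurableType d} {R : realType}.

Definition independent_RVs (P : probability T R) (n : nat)
    (X : 'I_n -> {mfun T >-> R}) : Prop :=
  forall (J : {set 'I_n}) (A : 'I_n -> set R),
    (forall i, measurable (A i)) ->
    P (\bigcap_(i in [set i | i \in J]) (X i @^-1` A i)) =
    (\big[*%E/1%:E]_(i in J) P (X i @^-1` A i))%E.

Definition gamma_sample (P : probability T R) (n : nat) (lambda alpha : R)
    (X : 'I_n -> {mfun T >-> R}) : Prop :=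
  independent_RVs P X /\
  forall i, has_density (distribution P (X i)) (gamma_density lambda alpha).

Definition sample_mean (n : nat) (X : 'I_n -> {mfun T >-> R}) (t : T) : R :=
  (\sum_(i < n) X i t) / n%:R.

Definition sample_variance (n : nat) (X : 'I_n -> {mfun T >-> R}) (t : T) : R :=
  (\sum_(i < n) (X i t - sample_mean X t) ^+ 2) / n%:R.

(* Where the sample variance vanishes (a null event for a gamma sample of
   size at least 2) the value is 0, by the convention 0^-1 = 0. *)
Definition moment_estimator (n : nat) (X : 'I_n -> {mfun T >-> R}) (t : T) : R :=
  sample_mean X t ^+ 2 / sample_variance X t.

Definition inv_mfun (Y : {mfun T >-> R}) (t : T) : R := (Y t)^-1.

Lemma measurable_sample_mean n (X : 'I_n -> {mfun T >-> R}) :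
  measurable_fun [set: T] (sample_mean X).
Proof.
apply: measurable_funM; last exact: measurable_cst.
by apply: measurable_sum => i; exact: measurable_funPT.
Qed.

Lemma measurable_inv_comp (f : T -> R) :
  measurable_fun [set: T] f -> measurable_fun [set: T] (fun t => (f t)^-1).
Proof.
move=> mf; apply: (@measurableT_comp _ _ _ _ _ _ (@GRing.inv R)) => //.
rewrite -(setUv [set 0 : R]); apply/measurable_funU; [exact: measurable_set1| |].
  by apply: measurableC; exact: measurable_set1.
split; first exact: measurable_fun_set1.
apply: open_continuous_measurable_fun.
  by apply: closed_openC; exact: closed_eq.
by apply/in_setP => x /= /eqP; exact: inv_continuous.
Qed.

Lemma measurable_sample_variance n (X : 'I_n -> {mfun T >-> R}) :
  measurable_fun [set: T] (sample_variance X).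
Proof.
apply: measurable_funM; last exact: measurable_cst.
apply: measurable_sum => i; apply: measurable_funX; apply: measurable_funB.
  exact: measurable_funPT.
exact: measurable_sample_mean.
Qed.

Lemma measurable_moment_estimator n (X : 'I_n -> {mfun T >-> R}) :
  measurable_fun [set: T] (moment_estimator X).
Proof.
apply: measurable_funM.
  by apply: measurable_funX; exact: measurable_sample_mean.
by apply: measurable_inv_comp; exact: measurable_sample_variance.
Qed.

HB.instance Definition _ n (X : 'I_n -> {mfun T >-> R}) :=
  isMeasurableFun.Build _ _ _ _ (moment_estimator X)
    (measurable_moment_estimator X).

HB.instance Definition _ (Y : {mfun T >-> R}) :=
  isMeasurableFun.Build _ _ _ _ (inv_mfun Y)
    (measurable_inv_comp (measurable_funPT Y)).

End samples.

(* Main.v *)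
(* For two gamma variables the scale cancels in U = (X2 - X1) / (X2 + X1), and
   1 / hat alpha = U^2. Substituting first x2 = x1 (1 + u) / (1 - u) and then
   x1 = (1 - u) z in the joint density, and exchanging the integrals in
   between, U gets a density proportional to (1 - u^2)^(alpha - 1) on
   ]-1, 1[; substituting w = u^2 on each half gives the beta density up to a
   factor, which is found from the total mass. So no relation between the gamma
   and beta functions is needed. The density of hat alpha is then
   beta(1/x) / x^2 on ]1, +oo[, and the likelihood ratio is a constant times
   (1 - 1/x)^(alpha2 - alpha1).
   Substitution for integrals over Borel sets follows from the theorem of the
   library for continuous integrands on segments by uniqueness of measures. *)
Require Import Defs.
From HB Require Import structures.
From mathcomp Require Import all_boot all_order all_algebra.
From mathcomp Require Import all_classical all_reals all_analysis measurable_realfun.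
From mathcomp Require Import ring lra.
Import Order.TTheory GRing.Theory Num.Theory.
Import numFieldNormedType.Exports.
Local Open Scope classical_set_scope.
Local Open Scope ring_scope.

(** * Image measures and uniqueness of Borel measures on the line *)

(** Presenting such integrals as a measure in the set [A] makes uniqueness of measures applicable to
    them. The case where [G] is the identity gives the measure of density [f] itself. *)
Lemma density_pushforward (d1 d2 : measure_display) (T1 : measurableType d1)
    (T2 : measurableType d2) (R : realType) (mu : {measure set T1 -> \bar R})
    (f : T1 -> \bar R) (G : T1 -> T2) :
  measurable_fun [set: T1] f -> (forall x, (0 <= f x)%E) ->
  measurable_fun [set: T1] G ->
  exists m : {measure set T2 -> \bar R},
    forall A, m A = (\int[mu]_(x in G @^-1` A) f x)%E.
Proof.
move=> mf f0 mG.
pose m (A : set T2) : \bar R := (\int[mu]_(x in G @^-1` A) f x)%E.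
have m0 : m set0 = 0%E by rewrite /m preimage_set0 integral_set0.
have m_ge0 A : (0 <= m A)%E by apply: integral_ge0 => x _; exact: f0.
have m_sigma : semi_sigma_additive m.
  move=> F mF tF mUF; rewrite /m preimage_bigcup ge0_integral_bigcup//.
  - by apply: is_cvg_ereal_nneg_natsum_cond => n _ _; exact: m_ge0.
  - by move=> k; rewrite -[X in measurable X]setTI; exact: mG.
  - exact: measurable_funTS.
  - apply/trivIsetP => i j _ _ ij; rewrite -preimage_setI.
    by move/trivIsetP : tF => /(_ _ _ _ _ ij) ->//; rewrite preimage_set0.
pose mixin := isMeasure.Build d2 T2 R m m0 m_ge0 m_sigma.
pose M : {measure set T2 -> \bar R} := HB.pack m mixin.
by exists M.
Qed.

(** Closed rays to the right form a generating family closed under intersection, and each meets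
    [[a, b]] in a segment or in the empty set. Finiteness on [[a, b]] then allows uniqueness of
    measures for the two restrictions. *)
Lemma eq_measure_subitv (R : realType) (m1 m2 : {measure set R -> \bar R})
    (a b : R) :
  (m1 `[a, b]%classic < +oo)%E ->
  (forall s t, a <= s -> s <= t -> t <= b ->
     m1 `[s, t]%classic = m2 `[s, t]%classic) ->
  forall B, measurable B ->
    m1 (`[a, b]%classic `&` B) = m2 (`[a, b]%classic `&` B).
Proof.
move=> fin_m1 m12 B mB.
have mab : measurable (`[a, b]%classic : set R) by [].
pose n1 : {measure set R -> \bar R} := mrestr m1 mab.
pose n2 : {measure set R -> \bar R} := mrestr m2 mab.
rewrite ![_ `&` B]setIC -[LHS]/(n1 B) -[RHS]/(n2 B).
apply: (measure_unique (@RGenCInfty.G R) (fun k => `[- k%:R, +oo[%classic)) => //.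
- exact: RGenCInfty.measurableE.
- move=> _ _ [x ->] [y ->]; exists (Num.max x y).
  by apply/seteqP; split => z /=; rewrite !in_itv/= !andbT ge_max => /andP.
- by move=> k; exists (- k%:R).
- apply/seteqP; split => // x _; exists (Num.truncn `|x|).+1 => //=.
  rewrite in_itv/= andbT lerNl; apply: (le_trans (ler_norm _)).
  by rewrite normrN ltW// truncnS_gt.
- move=> _ [x ->]; rewrite /n1 /n2 /= /mrestr.
  have -> : `[x, +oo[ `&` `[a, b] = `[Num.max a x, b]%classic.
    apply/seteqP; split => z /=; rewrite !in_itv/= andbT ge_max.
      by move=> [-> /andP[-> ->]].
    by move=> /andP[/andP[-> ->] ->].
  have [axb|bax] := leP (Num.max a x) b.
    by apply: m12 => //; rewrite le_max lexx.
  by rewrite set_itv_ge ?measure0// bnd_simp -ltNge.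
- move=> k; apply: le_lt_trans fin_m1; rewrite /n1 /= /mrestr.
  by apply: le_measure; rewrite ?inE//; exact: measurableI.
Qed.

(** The segments with rational endpoints inside the open set [I] are countably many and cover it.
    Together with the complement of [I], null for both measures, they cover the line, and on each of
    these sets the measures agree. *)
Lemma eq_measure_open (R : realType) (m1 m2 : {measure set R -> \bar R})
    (I : set R) :
  open I -> m1 (~` I) = 0%E -> m2 (~` I) = 0%E ->
  (forall s t, s <= t -> `[s, t]%classic `<=` I ->
     m1 `[s, t]%classic = m2 `[s, t]%classic /\ (m1 `[s, t]%classic < +oo)%E) ->
  forall B, measurable B -> m1 B = m2 B.
Proof.
move=> oI m1I m2I m12 B mB.
have mI : measurable I by exact: open_measurable.
(* Index 0 is the complement of [I]. Index [k.+1] decodes [k] as a pair of rationals and keeps the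
   segment only if it lies in [I]; all other codes give the empty set. *)
pose g n : set R := if n is k.+1 then
    if unpickle k is Some (p, q) then
      let K := `[ratr p, ratr q]%classic : set R in
      if `[< K `<=` I >] then K else set0
    else set0
  else ~` I.
apply: (@g_sigma_algebra_measure_unique_cover _ _ _ measurable (fun=> id) g
  _ _ m1 m2 _ B).
- move=> [|k] /=; first exact: measurableC.
  by case: unpickle => [[p q]|//]; case: ifP.
- apply/seteqP; split => // x _.
  have [Ix|nIx] := pselect (I x); last by exists 0%N.
  have /nbhs_ballP[e /= e0 xeI] : nbhs x I by exact: open_nbhs_nbhs.
  have [p /andP[xep px]] : exists p : rat, x - e < ratr p < x.
    have /rat_in_itvoo[p] : x - e < x by rewrite ltrBlDr ltrDl.
    by rewrite in_itv/=; exists p.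
  have [q /andP[xq qxe]] : exists q : rat, x < ratr q < x + e.
    have /rat_in_itvoo[q] : x < x + e by rewrite ltrDl.
    by rewrite in_itv/=; exists q.
  have [k kpq] : exists k, unpickle k = Some (p, q).
    by exists (pickle (p, q)); rewrite pickleK.
  exists k.+1 => //; rewrite /g kpq.
  case: asboolP => [_|[]]; first by rewrite /= in_itv/= !ltW.
  move=> z; rewrite /= in_itv/= => /andP[pz zq]; apply: xeI.
  by rewrite /ball/= ltr_distlC (lt_le_trans xep pz) (le_lt_trans zq qxe).
- move=> k A; rewrite sigma_algebra_id; last exact: sigma_algebra_measurable.
  move=> mA; case: k => [|k].
    have mIA : measurable (~` I `&` A).
      by apply: measurableI => //; exact: measurableC.
    have sub0 (m : {measure set R -> \bar R}) :
        m (~` I) = 0%E -> m (~` I `&` A) = 0%E.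
      by apply: subset_measure0 => //; exact: measurableC.
    by rewrite [LHS]sub0// [RHS]sub0.
  rewrite /g; case: unpickle => [[p q]|]; last by rewrite set0I !measure0.
  case: asboolP => [pqI|_]; last by rewrite set0I !measure0.
  have [pq|qp] := leP (ratr p : R) (ratr q); last first.
    by rewrite set_itv_ge ?set0I ?measure0// bnd_simp -ltNge.
  apply: eq_measure_subitv => //; first exact: (m12 _ _ pq pqI).2.
  move=> s t ps st tq; apply: (m12 _ _ st _).1 => z /= zst; apply: pqI.
  move: zst; rewrite /= !in_itv/= => /andP[sz zt].
  by rewrite (le_trans ps sz) (le_trans zt tq).
- by rewrite sigma_algebra_id//; exact: sigma_algebra_measurable.
Qed.

(** Both sides are measures in [B] that vanish off [I], so agreement on segments of [I] suffices.
    Their finiteness there comes from the continuity of [k] on a compact segment. *)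
Lemma integral_density_image (R : realType) (I J : set R) (G h k : R -> R) :
  open I -> measurable J -> measurable_fun [set: R] G ->
  (forall y, J y -> I (G y)) ->
  measurable_fun J h -> (forall y, J y -> 0 <= h y) ->
  {in I, continuous k} -> (forall u, I u -> 0 <= k u) ->
  (forall s t, s <= t -> `[s, t]%classic `<=` I ->
     (\int[lebesgue_measure]_(y in J `&` G @^-1` `[s, t]) (h y)%:E =
      \int[lebesgue_measure]_(u in `[s, t]) (k u)%:E)%E) ->
  forall B, measurable B ->
    (\int[lebesgue_measure]_(y in J `&` G @^-1` B) (h y)%:E =
     \int[lebesgue_measure]_(u in I `&` B) (k u)%:E)%E.
Proof.
move=> oI mJ mG JI mh h0 ck k0 hk B mB.
have mI : measurable I by exact: open_measurable.
have mk : measurable_fun I k by exact: open_continuous_measurable_fun.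
have [m1 m1E] : exists m : {measure set R -> \bar R}, forall A,
    m A = (\int[lebesgue_measure]_(y in J `&` G @^-1` A) (h y)%:E)%E.
  have [||m mE] := @density_pushforward _ _ (measurableTypeR R) R R
    lebesgue_measure ((EFin \o h) \_ J) G _ _ mG.
  - by apply/(measurable_restrictT _ mJ); exact/measurable_EFinP.
  - by apply: erestrict_ge0 => y /h0; rewrite lee_fin.
  - by exists m => A; rewrite mE -integral_mkcondl.
have [m2 m2E] : exists m : {measure set R -> \bar R}, forall A,
    m A = (\int[lebesgue_measure]_(u in I `&` A) (k u)%:E)%E.
  have [|||m mE] := @density_pushforward _ _ (measurableTypeR R) R R
    lebesgue_measure ((EFin \o k) \_ I) id.
  - by apply/(measurable_restrictT _ mI); exact/measurable_EFinP.
  - by apply: erestrict_ge0 => y /k0; rewrite lee_fin.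
  - exact: measurable_id.
  - by exists m => A; rewrite mE -integral_mkcondl.
rewrite -m1E -m2E; apply: (@eq_measure_open _ m1 m2 I) => //.
- rewrite m1E (_ : _ `&` _ = set0) ?integral_set0//.
  by apply/seteqP; split => // y [/JI].
- by rewrite m2E setICr integral_set0.
- move=> s t st stI; rewrite m1E m2E (setIidr stI) hk//; split => //.
  have : lebesgue_measure.-integrable (`[s, t] : set R) (EFin \o k).
    apply: continuous_compact_integrable; first exact: segment_compact.
    apply: continuous_in_subspaceT => u; rewrite inE => /stI Iu.
    by apply: ck; rewrite inE.
  by move=> /integrable_lty; exact.
Qed.

(** * Monotone change of variables between open sets, over Borel sets *)

Lemma eq_continuous_open (R : realType) (I : set R) (f g : R -> R) :
  open I -> (forall x, I x -> f x = g x) ->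
  {in I, continuous f} -> {in I, continuous g}.
Proof.
move=> oI fg cf x xI; have Ix : I x by rewrite inE in xI.
have /near_eq_cvg fgx : {near x, f =1 g}.
  by near=> y; apply: fg; near: y; exact: open_nbhs_nbhs.
by rewrite /continuous_at -fg//; apply: cvg_trans fgx (cf _ xI).
Unshelve. all: end_near. Qed.

Lemma continuous_derive1_open (R : realType) (I : set R) (F f : R -> R) :
  open I -> (forall u, I u -> is_derive u (1 : R) F (f u)) ->
  {in I, continuous f} -> {in I, continuous (derive1 F)}.
Proof.
move=> oI dF; apply: eq_continuous_open => // u /dF ?.
by rewrite derive1E derive_val.
Qed.

Lemma derivable_oo_LRcontinuous_open (R : realType) (I : set R) (F f : R -> R)
    (s t : R) :
  (forall u, I u -> is_derive u (1 : R) F (f u)) ->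
  s <= t -> `[s, t]%classic `<=` I -> derivable_oo_LRcontinuous F s t.
Proof.
move=> dF st stI.
have cF u : I u -> {for u, continuous F}.
  by move=> /dF ?; apply: differentiable_continuous; exact/derivable1_diffP.
split.
- move=> u ust; have /dF : I u by apply: stI; exact: subset_itv_oo_cc ust.
  by move=> ?.
- by apply: cvg_at_right_filter; apply/cF/stI; rewrite /= in_itv/= lexx.
- by apply: cvg_at_left_filter; apply/cF/stI; rewrite /= in_itv/= lexx andbT.
Qed.

(** [F] and [G] are inverse bijections between [I] and [J], so the points of [J] that [G] sends into
    [[s, t]] form the segment [[F s, F t]]. Substitution for continuous integrands applies on it,
    and [integral_density_image] extends the result to Borel sets. *)
Lemma ge0_integral_substitution_increasing (R : realType) (I J : set R)
    (F G f h : R -> R) :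
  open I -> open J -> is_interval J -> measurable_fun [set: R] G ->
  (forall u, I u -> J (F u) /\ G (F u) = u) ->
  (forall y, J y -> I (G y) /\ F (G y) = y) ->
  {in I &, {homo F : x y / x < y}} ->
  (forall u, I u -> is_derive u (1 : R) F (f u)) ->
  {in I, continuous f} -> (forall u, I u -> 0 <= f u) ->
  {in J, continuous h} -> (forall y, J y -> 0 <= h y) ->
  forall B, measurable B ->
    (\int[lebesgue_measure]_(y in J `&` G @^-1` B) (h y)%:E =
     \int[lebesgue_measure]_(u in I `&` B) (h (F u) * f u)%:E)%E.
Proof.
move=> oI oJ iJ mG IJ JI incF dF cf f0 ch h0.
have cF u : I u -> {for u, continuous F}.
  by move=> /dF ?; apply: differentiable_continuous; exact/derivable1_diffP.
apply: integral_density_image => //.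
- exact: open_measurable.
- by move=> y /JI[].
- exact: open_continuous_measurable_fun.
- move=> u uI; have Iu : I u by rewrite inE in uI.
  apply: continuousM; last exact: cf.
  apply: continuous_comp; first exact: cF.
  by apply: ch; rewrite inE; exact: (IJ _ Iu).1.
- by move=> u Iu; rewrite mulr_ge0 ?f0// h0//; exact: (IJ _ Iu).1.
- move=> s t st stI.
  have Is : I s by apply: stI; rewrite /= in_itv/= lexx.
  have It : I t by apply: stI; rewrite /= in_itv/= lexx andbT.
  have leF : {in I &, {mono F : x y / x <= y}} by exact: le_mono_in.
  have JE : J `&` G @^-1` `[s, t] = `[F s, F t]%classic.
    apply/seteqP; split => y /=; rewrite !in_itv/=.
      by move=> [/JI[IGy GyE]];
        rewrite -[s <= _]leF ?inE// -[_ <= t]leF ?inE// GyE.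
    (* [J] is an interval containing [F s] and [F t], hence every point between them. *)
    move=> sFt; have Jy : J y.
      by apply: iJ sFt; [exact: (IJ _ Is).1|exact: (IJ _ It).1].
    by split => //; have [IGy GyE] := JI _ Jy;
        rewrite -[s <= _]leF ?inE// -[_ <= t]leF ?inE// GyE.
  have inI u : u \in `[s, t] -> u \in I by move=> ust; rewrite inE; exact: stI.
  have cF' := continuous_derive1_open _ _ _ _ oI dF cf.
  have monoF : {in `[s, t] &, {homo F : x y / x < y}}.
    by move=> x y xst yst; apply: incF; exact: inI.
  have cF'st : {in `]s, t[, continuous (derive1 F)}.
    by move=> u /subset_itv_oo_cc /inI; exact: cF'.
  have F's : cvg (derive1 F x @[x --> s^'+]).
    by apply/cvg_ex; exists (derive1 F s); apply: cvg_at_right_filter;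
      apply: cF'; rewrite inE.
  have F't : cvg (derive1 F x @[x --> t^'-]).
    by apply/cvg_ex; exists (derive1 F t); apply: cvg_at_left_filter;
      apply: cF'; rewrite inE.
  have dFst := derivable_oo_LRcontinuous_open _ _ _ _ _ _ dF st stI.
  have chst : {within `[F s, F t], continuous h}.
    apply: continuous_in_subspaceT => y; rewrite inE -JE => -[Jy _].
    by apply: ch; rewrite inE.
  rewrite JE (integration_by_substitution_increasing st monoF cF'st F's F't
    dFst chst).
  apply: eq_integral => u; rewrite inE => /stI /dF ?.
  have F'E : derive1 F u = f u by rewrite derive1E derive_val.
  by rewrite !fctE F'E.
Qed.

(** The derivative is written [- f], so that [f] is its absolute value and the conclusion reads as
    in the increasing case. Only the endpoints of the image segment are swapped. *)
Lemma ge0_integral_substitution_decreasing (R : realType) (I J : set R)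
    (F G f h : R -> R) :
  open I -> open J -> is_interval J -> measurable_fun [set: R] G ->
  (forall u, I u -> J (F u) /\ G (F u) = u) ->
  (forall y, J y -> I (G y) /\ F (G y) = y) ->
  {in I &, {homo F : x y /~ x < y}} ->
  (forall u, I u -> is_derive u (1 : R) F (- f u)) ->
  {in I, continuous f} -> (forall u, I u -> 0 <= f u) ->
  {in J, continuous h} -> (forall y, J y -> 0 <= h y) ->
  forall B, measurable B ->
    (\int[lebesgue_measure]_(y in J `&` G @^-1` B) (h y)%:E =
     \int[lebesgue_measure]_(u in I `&` B) (h (F u) * f u)%:E)%E.
Proof.
move=> oI oJ iJ mG IJ JI decF dF cf f0 ch h0.
have cF u : I u -> {for u, continuous F}.
  by move=> /dF ?; apply: differentiable_continuous; exact/derivable1_diffP.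
apply: integral_density_image => //.
- exact: open_measurable.
- by move=> y /JI[].
- exact: open_continuous_measurable_fun.
- move=> u uI; have Iu : I u by rewrite inE in uI.
  apply: continuousM; last exact: cf.
  apply: continuous_comp; first exact: cF.
  by apply: ch; rewrite inE; exact: (IJ _ Iu).1.
- by move=> u Iu; rewrite mulr_ge0 ?f0// h0//; exact: (IJ _ Iu).1.
- move=> s t st stI.
  have Is : I s by apply: stI; rewrite /= in_itv/= lexx.
  have It : I t by apply: stI; rewrite /= in_itv/= lexx andbT.
  have leF : {in I &, {mono F : x y /~ x <= y}} by exact: le_nmono_in.
  have JE : J `&` G @^-1` `[s, t] = `[F t, F s]%classic.
    apply/seteqP; split => y /=; rewrite !in_itv/=.
      by move=> [/JI[IGy GyE]];
        rewrite -[s <= _]leF ?inE// -[_ <= t]leF ?inE// GyE andbC.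
    move=> tFs; have Jy : J y.
      by apply: iJ tFs; [exact: (IJ _ It).1|exact: (IJ _ Is).1].
    by split => //; have [IGy GyE] := JI _ Jy;
        rewrite -[s <= _]leF ?inE// -[_ <= t]leF ?inE// GyE andbC.
  have inI u : u \in `[s, t] -> u \in I by move=> ust; rewrite inE; exact: stI.
  have cF' : {in I, continuous (derive1 F)}.
    apply: (continuous_derive1_open _ _ _ _ oI dF) => u uI.
    by apply: continuousN; exact: cf.
  have monoF : {in `[s, t] &, {homo F : x y /~ x < y}}.
    by move=> x y xst yst; apply: decF; exact: inI.
  have cF'st : {in `]s, t[, continuous (derive1 F)}.
    by move=> u /subset_itv_oo_cc /inI; exact: cF'.
  have F's : cvg (derive1 F x @[x --> s^'+]).
    by apply/cvg_ex; exists (derive1 F s); apply: cvg_at_right_filter;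
      apply: cF'; rewrite inE.
  have F't : cvg (derive1 F x @[x --> t^'-]).
    by apply/cvg_ex; exists (derive1 F t); apply: cvg_at_left_filter;
      apply: cF'; rewrite inE.
  have dFst := derivable_oo_LRcontinuous_open _ _ _ _ _ _ dF st stI.
  have chst : {within `[F t, F s], continuous h}.
    apply: continuous_in_subspaceT => y; rewrite inE -JE => -[Jy _].
    by apply: ch; rewrite inE.
  rewrite JE (integration_by_substitution_decreasing st monoF cF'st F's F't
    dFst chst).
  apply: eq_integral => u; rewrite inE => /stI /dF ?.
  have F'E : derive1 F u = - f u by rewrite derive1E derive_val.
  by rewrite !fctE F'E opprK.
Qed.

(** * Joint law of two independent variables with densities *)

(** Measurable rectangles are closed under intersection and generate the product sigma-algebra. On
    them the formula is independence, so uniqueness of measures gives it for every measurable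
    [E]. *)
Lemma joint_distribution_density (d : measure_display) (T : measurableType d)
    (R : realType) (P : probability T R) (X Y : {mfun T >-> R}) (f g : R -> R) :
  has_density (distribution P X) f -> has_density (distribution P Y) g ->
  (forall A B, measurable A -> measurable B ->
     P (X @^-1` A `&` Y @^-1` B) = (P (X @^-1` A) * P (Y @^-1` B))%E) ->
  forall E : set (R * R), measurable E ->
    P ((fun t => (X t, Y t)) @^-1` E) =
    (\int[lebesgue_measure]_x \int[lebesgue_measure]_(y in xsection E x)
       (f x * g y)%:E)%E.
Proof.
move=> [mf f0 fE] [mg g0 gE] XY E mE.
pose Z t := (X t, Y t).
have mZ : measurable_fun [set: T] Z by exact: measurable_fun_pair.
pose mixin := isMeasurableFun.Build _ _ _ _ Z mZ.
pose mfunZ : {mfun T >-> (R * R)%type} := HB.pack Z mixin.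
pose n : {measure set (R * R) -> \bar R} := distribution P mfunZ.
pose la := @lebesgue_measure R.
pose h (z : R * R) := (f z.1 * g z.2)%:E.
have mh : measurable_fun [set: measurableTypeR R * measurableTypeR R] h.
  apply/measurable_EFinP; apply: measurable_funM.
    exact: (measurableT_comp mf measurable_fst).
  exact: (measurableT_comp mg measurable_snd).
have h0 z : (0 <= h z)%E by rewrite lee_fin mulr_ge0.
have [m mmE] : exists m : {measure set (R * R) -> \bar R},
    forall A, m A = (\int[(la \x la)%E]_(z in A) h z)%E.
  have [|//||m mmE] := @density_pushforward _ _
    (measurableTypeR R * measurableTypeR R)%type (R * R)%type R (la \x la)%E h id.
  - exact: mh.
  - exact: measurable_id.
  - by exists m.
(* Tonelli turns the integral of the product density over [A] into iterated integrals over the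
   sections of [A]. *)
have mE' A : measurable A -> m A =
    (\int[la]_x \int[la]_(y in xsection A x) (f x * g y)%:E)%E.
  move=> mA; rewrite mmE integral_mkcond fubini_tonelli1//.
  - apply: eq_integral => x _; rewrite /fubini_F [RHS]integral_mkcond.
    by apply: eq_integral => y _; rewrite /patch mem_xsection.
  - exact/(measurable_restrictT _ mA)/measurable_funTS.
  - by apply: erestrict_ge0.
transitivity (n E) => //; rewrite -mE'//.
pose C := [set A `*` B | A in @measurable _ R & B in @measurable _ R].
apply: (measure_unique C (fun=> setT)) => //.
- exact: measurable_prod_measurableType.
- move=> _ _ [A1 mA1 [B1 mB1 <-]] [A2 mA2 [B2 mB2 <-]].
  rewrite -setXI; exists (A1 `&` A2); first exact: measurableI.
  by exists (B1 `&` B2) => //; exact: measurableI.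
- by move=> _; exists setT => //; exists setT => //; rewrite setXTT.
- by apply/seteqP; split => // z _; exists 0%N.
(* The section of a rectangle [A] times [B] at [x] is [B] if [x] is in [A] and empty otherwise, so
   the iterated integral factors. *)
- move=> _ [A mA [B mB <-]]; rewrite mE'; last exact: measurableX.
  rewrite [LHS](_ : _ = P (X @^-1` A `&` Y @^-1` B))// XY//.
  have -> : P (X @^-1` A) = (\int[la]_(x in A) (f x)%:E)%E := fE _ mA.
  have -> : P (Y @^-1` B) = (\int[la]_(y in B) (g y)%:E)%E := gE _ mB.
  rewrite [in LHS]integral_mkcond -ge0_integralZr//; last 3 first.
  + by apply/(measurable_restrictT _ mA)/measurable_EFinP; exact: measurable_funTS.
  + by move=> x _; apply: erestrict_ge0 => y _; rewrite lee_fin.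
  + by apply: integral_ge0 => y _; rewrite lee_fin.
  apply: eq_integral => x _; rewrite patchE; case: ifPn => xA.
    rewrite in_xsectionX// -ge0_integralZl//.
    * by apply/measurable_EFinP; exact: measurable_funTS.
    * by move=> y _; rewrite lee_fin.
    * by rewrite lee_fin.
  by rewrite notin_xsectionX// integral_set0 mul0e.
- by move=> _; rewrite /n /= (le_lt_trans (probability_le1 _ _))// ltry.
Qed.

(** * The particular substitutions and the exchange of integrals *)

Lemma continuous_powR_at (R : realType) (a x : R) :
  0 < x -> {for x, continuous (fun y : R => y `^ a)}.
Proof.
move=> x0; apply: differentiable_continuous; apply/derivable1_diffP.
have [] // : is_derive x (1 : R) (fun y : R => y `^ a) (a * x `^ (a - 1)).
exact: is_derive1_powR.
Qed.

(** Squaring maps each of the halves []-1, 0[] and []0, 1[] bijectively onto []0, 1[]. Each half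
    contributes the Jacobian [(2 * Num.sqrt w)^-1], and the two add up to [(Num.sqrt w)^-1]. *)
Lemma ge0_integral_substitution_sqr (R : realType) (p : R -> R) :
  measurable_fun [set: R] p -> {in `]0, 1[%classic, continuous p} ->
  (forall w, 0 <= p w) ->
  forall A, measurable A ->
    (\int[lebesgue_measure]_(u in `]((-1)%R : R), 1%R[ `&`
         (fun x : R => x ^+ 2)%R @^-1` A)
       (p (u ^+ 2))%:E =
     \int[lebesgue_measure]_(w in `](0%R : R), 1%R[ `&` A)
       (p w * (Num.sqrt w)^-1)%:E)%E.
Proof.
move=> mp cp p0 A mA.
pose sqr (x : R) := x ^+ 2.
have msqr : measurable_fun [set: R] sqr by exact: measurable_funX.
have mS : measurable (sqr @^-1` A).
  by rewrite -[X in measurable X]setTI; exact: msqr.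
have mps : measurable_fun [set: R] (fun u => p (sqr u)).
  exact: measurableT_comp.
pose f (w : R) : R := (2 * Num.sqrt w)^-1.
have cf : {in `]0, 1[%classic, continuous f}.
  move=> w; rewrite inE/= in_itv/= => /andP[w0 _].
  apply: cvgV; first by rewrite mulf_neq0// gt_eqF// sqrtr_gt0.
  by apply: cvgM; [exact: cvg_cst|exact: sqrt_continuous].
have f0 (w : R) : `]0, 1[%classic w -> 0 <= f w.
  by move=> _; rewrite invr_ge0 mulr_ge0// sqrtr_ge0.
have ch (J : set R) : (forall u, J u -> 0 < u ^+ 2 < 1) ->
    {in J, continuous (fun u => p (sqr u))}.
  move=> J01 u; rewrite inE => /J01 u01; apply: continuous_comp.
    exact: exprn_continuous.
  by apply: cp; rewrite inE/= in_itv.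
have dsqrt (u : R) : `]0, 1[%classic u -> is_derive u (1 : R) Num.sqrt (f u).
  by rewrite /= in_itv/= => /andP[u0 _]; exact: is_derive1_sqrt.
have dNsqrt (u : R) : `]0, 1[%classic u ->
    is_derive u (1 : R) (fun w : R => - Num.sqrt w) (- f u).
  by move=> /dsqrt ?; exact: is_deriveN.
have pos : (\int[lebesgue_measure]_(u in `](0%R : R), 1%R[ `&` sqr @^-1` A)
     (p (u ^+ 2))%:E =
   \int[lebesgue_measure]_(w in `](0%R : R), 1%R[ `&` A) (p w * f w)%:E)%E.
  rewrite (@ge0_integral_substitution_increasing R `]0, 1[%classic `]0, 1[%classic
    Num.sqrt sqr f (fun u => p (sqr u)))//.
  - apply: eq_integral => w; rewrite inE/= in_itv/= => -[/andP[w0 w1] _].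
    by rewrite /sqr sqr_sqrtr// ltW.
  - exact: interval_is_interval.
  - move=> u; rewrite /= !in_itv/= => /andP[u0 u1].
    by rewrite sqrtr_gt0 u0/= -[ltRHS]sqrtr1 ltr_sqrt// u1 /sqr sqr_sqrtr// ltW.
  - move=> u; rewrite /= !in_itv/= => /andP[u0 u1].
    by rewrite /sqr sqrtr_sqr gtr0_norm// exprn_gt0// exprn_ilt1// ltW.
  - by move=> x y; rewrite !inE/= !in_itv/= => /andP[x0 _] /andP[y0 _] xy;
      rewrite ltr_sqrt.
  - apply: ch => u; rewrite /= in_itv/= => /andP[u0 u1].
    by rewrite exprn_gt0// exprn_ilt1// ltW.
have neg : (\int[lebesgue_measure]_(u in `]((-1)%R : R), 0%R[ `&` sqr @^-1` A)
     (p (u ^+ 2))%:E =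
   \int[lebesgue_measure]_(w in `](0%R : R), 1%R[ `&` A) (p w * f w)%:E)%E.
  rewrite (@ge0_integral_substitution_decreasing R `]0, 1[%classic `]-1, 0[%classic
    (fun w : R => - Num.sqrt w) sqr f (fun u => p (sqr u)))//.
  - apply: eq_integral => w; rewrite inE/= in_itv/= => -[/andP[w0 w1] _].
    by rewrite /sqr sqrrN sqr_sqrtr// ltW.
  - exact: interval_is_interval.
  - move=> u; rewrite /= !in_itv/= => /andP[u0 u1].
    by rewrite oppr_lt0 sqrtr_gt0 u0 ltrN2 -[ltRHS]sqrtr1 ltr_sqrt// u1
      /sqr sqrrN sqr_sqrtr// ltW.
  - move=> u; rewrite /= !in_itv/= => /andP[u0 u1].
    rewrite /sqr sqrtr_sqr ltr0_norm// opprK -sqrrN exprn_gt0 ?oppr_gt0//.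
    by rewrite exprn_ilt1// ?oppr_ge0 ?ltW// ltrNl.
  - by move=> x y; rewrite !inE/= !in_itv/= => /andP[x0 _] /andP[y0 _] xy;
      rewrite ltrN2 ltr_sqrt.
  - apply: ch => u; rewrite /= in_itv/= => /andP[u0 u1].
    by rewrite -sqrrN exprn_gt0 ?oppr_gt0// exprn_ilt1// ?oppr_ge0 ?ltW// ltrNl.
have mpS : measurable_fun [set: R] ((fun u => (p (sqr u))%:E) \_ (sqr @^-1` A)).
  apply/(measurable_restrictT _ mS)/measurable_funTS; exact/measurable_EFinP.
have pS0 u : (0 <= ((fun u => (p (sqr u))%:E) \_ (sqr @^-1` A)) u)%E.
  by apply: erestrict_ge0 => v _; rewrite lee_fin.
have -> : (\int[lebesgue_measure]_(u in `]((-1)%R : R), 1%R[ `&` sqr @^-1` A)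
     (p (u ^+ 2))%:E =
   \int[lebesgue_measure]_(u in `]((-1)%R : R), 0%R[ `&` sqr @^-1` A)
     (p (u ^+ 2))%:E +
   \int[lebesgue_measure]_(u in `](0%R : R), 1%R[ `&` sqr @^-1` A)
     (p (u ^+ 2))%:E)%E.
  (* The point 0 is first attached to the negative half and then dropped as a null set. *)
  rewrite !integral_mkcondr.
  have -> : `]-1, 1[%classic = `]-1, 0] `|` `]0, 1[ :> set R.
    by rewrite -itv_bndbnd_setU// bnd_simp.
  rewrite ge0_integral_setU//.
  - congr (_ + _)%E; rewrite [RHS]integral_itv_bndo_bndc//.
    exact: measurable_funTS.
  - exact: measurable_funTS.
  - rewrite disj_set2E; apply/eqP/seteqP; split => // x [] /=.
    by rewrite !in_itv/= => /andP[_ x0] /andP[]; rewrite ltNge x0.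
have mpf : measurable_fun ((`]0, 1[%classic : set R) `&` A) (fun w => (p w * f w)%:E).
  have mf : measurable_fun (`]0, 1[%classic : set R) f.
    by apply: open_continuous_measurable_fun; [exact: interval_open|exact: cf].
  apply/measurable_EFinP/measurable_funM; first exact: measurable_funTS.
  by apply: measurable_funS mf.
have pf0 w : ((`]0, 1[%classic : set R) `&` A) w -> (0 <= (p w * f w)%:E)%E.
  by move=> [w01 _]; rewrite lee_fin mulr_ge0// f0.
rewrite pos neg -ge0_integralD//; last exact: measurableI.
apply: eq_integral => w _; rewrite -EFinD -mulrDr /f invfM -mulrDl.
by rewrite -[2^-1]mul1r -splitr mul1r.
Qed.

(** Since [q] is only known to be nonnegative on the rectangle, it is extended by 0 outside before
    Tonelli is applied on the whole plane. *)
Lemma ge0_fubini_tonelli_setX (R : realType) (A B : set R) (q : R * R -> R) :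
  measurable A -> measurable B -> measurable_fun [set: R * R] q ->
  (forall x y, A x -> B y -> 0 <= q (x, y)) ->
  (\int[lebesgue_measure]_(x in A) \int[lebesgue_measure]_(y in B)
     (q (x, y))%:E =
   \int[lebesgue_measure]_(y in B) \int[lebesgue_measure]_(x in A)
     (q (x, y))%:E)%E.
Proof.
move=> mA mB mq q0.
have mAB : measurable (A `*` B) by exact: measurableX.
pose la := @lebesgue_measure R.
pose h := (EFin \o q) \_ (A `*` B).
have mh : measurable_fun [set: measurableTypeR R * measurableTypeR R] h.
  by apply/(measurable_restrictT _ mAB)/measurable_EFinP/measurable_funTS.
have h0 z : (0 <= h z)%E.
  by apply: erestrict_ge0 => -[x y] [/= Ax By]; rewrite lee_fin q0.
transitivity (\int[la]_x \int[la]_y h (x, y))%E.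
  rewrite integral_mkcond; apply: eq_integral => x _; rewrite patchE.
  case: ifPn => xA.
    rewrite integral_mkcond; apply: eq_integral => y _.
    by rewrite /h !patchE in_setX xA.
  rewrite integral0_eq// => y _.
  by rewrite /h patchE in_setX (negbTE xA).
transitivity (\int[la]_y \int[la]_x h (x, y))%E.
  exact: (@fubini_tonelli _ _ (measurableTypeR R) (measurableTypeR R) R la la h).
rewrite [RHS]integral_mkcond; apply: eq_integral => y _; rewrite [RHS]patchE.
case: ifPn => yB.
  rewrite [RHS]integral_mkcond; apply: eq_integral => x _.
  by rewrite /h !patchE in_setX yB andbT.
rewrite integral0_eq// => x _.
by rewrite /h patchE in_setX (negbTE yB) andbF.
Qed.

(** Solving [u = (y - x) / (y + x)] for [y] gives [x * (1 + u) / (1 - u)], an increasing bijection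
    from []-1, 1[] onto []0, +oo[]. In the form [2 * x / (1 - u) - x] the variable [u] occurs once
    and the derivative is immediate. *)
Lemma integral_ratio_substitution (R : realType) (f : R -> R) (x : R)
    (B : set R) :
  (forall y, 0 <= f y) -> {in `]0, +oo[%classic, continuous f} ->
  0 < x -> measurable B ->
  (\int[lebesgue_measure]_(y in `](0%R : R), +oo[ `&`
       (fun y : R => (y - x) / (y + x))%R @^-1` B) (f y)%:E =
   \int[lebesgue_measure]_(u in `]((-1)%R : R), 1%R[ `&` B)
     (f (2 * x / (1 - u) - x) * (2 * x / (1 - u) ^+ 2))%:E)%E.
Proof.
move=> f0 cf x0 mB.
pose I : set R := `]-1, 1[%classic.
pose J : set R := `]0, +oo[%classic.
pose F (u : R) := 2 * x / (1 - u) - x.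
pose G (y : R) := (y - x) / (y + x).
pose k (u : R) : R := 2 * x / (1 - u) ^+ 2.
have u1_gt0 (u : R) : I u -> 0 < 1 - u.
  by rewrite /I /= in_itv/= subr_gt0 => /andP[].
have dF (u : R) : I u -> is_derive u (1 : R) F (k u).
  move=> /u1_gt0 u1; have u10 : 1 - u != 0 by rewrite gt_eqF.
  rewrite /F; apply: is_derive_eq.
  by rewrite add0r mul1r subr0 /GRing.scale/= mulrNN mulr1.
have oJ : open J by exact: interval_open.
have oI : open I by exact: interval_open.
have iJ : is_interval J by exact: interval_is_interval.
have mG : measurable_fun [set: R] G.
  apply: measurable_funM; first exact: measurable_funB.
  by apply: measurable_inv_comp; exact: measurable_funD.
have x2 : 0 < 2 * x by rewrite mulr_gt0.
have IJ u : I u -> J (F u) /\ G (F u) = u.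
  move=> Iu; have u1 := u1_gt0 _ Iu; move: Iu.
  rewrite /I /J /= !in_itv/= andbT => /andP[u0 _]; split.
    by rewrite /F subr_gt0 ltr_pdivlMr// mulrC ltr_pM2r// ltrBlDr -ltrBlDl; lra.
  by rewrite /G /F; field; rewrite !gt_eqF//; lra.
have JI y : J y -> I (G y) /\ F (G y) = y.
  rewrite /I /J /= !in_itv/= andbT => y0.
  have xy : 0 < y + x by rewrite addr_gt0.
  split; last by rewrite /G /F; field; rewrite !gt_eqF//; lra.
  by rewrite /G ltr_pdivlMr// ltr_pdivrMr//; apply/andP; split; lra.
have incF : {in I &, {homo F : u v / u < v}}.
  move=> u v; rewrite !inE => /u1_gt0 u0 /u1_gt0 v0 uv.
  by rewrite /F ltrD2r ltr_pM2l// ltf_pV2//; lra.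
have ck : {in I, continuous k}.
  move=> u; rewrite inE => /u1_gt0 u0.
  apply: cvgM; first exact: cvg_cst.
  apply: cvgV; first by rewrite gt_eqF// exprn_gt0.
  apply: (@cvg_comp _ _ _ (fun v : R => 1 - v) (fun v => v ^+ 2)); last first.
    exact: exprn_continuous.
  by apply: cvgB; [exact: cvg_cst|exact: cvg_id].
have k0 u : I u -> 0 <= k u.
  by move=> /u1_gt0 u0; rewrite divr_ge0 ?exprn_ge0// ltW.
exact: (@ge0_integral_substitution_increasing R I J F G k f).
Qed.

Lemma integral_scale_gt0 (R : realType) (c : R) (h : R -> R) :
  0 < c -> {in `]0, +oo[%classic, continuous h} ->
  (forall x, 0 < x -> 0 <= h x) ->
  (\int[lebesgue_measure]_(x in `](0%R : R), +oo[) (h x)%:E =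
   \int[lebesgue_measure]_(z in `](0%R : R), +oo[) (h (c * z) * c)%:E)%E.
Proof.
move=> c0 ch h0.
pose J : set R := `]0, +oo[%classic.
have gt0J (x : R) : J x <-> 0 < x by rewrite /J /= in_itv/= andbT.
have dF (z : R) : J z -> is_derive z (1 : R) (fun z => c * z) ((cst c : R -> R) z).
  by move=> _; apply: is_derive_eq; rewrite /GRing.scale/= mulr1.
have := @ge0_integral_substitution_increasing R J J (fun z => c * z)
  (fun x => x / c) (cst c) h _ _ _ _ _ _ _ dF _ _ ch _ setT measurableT.
rewrite preimage_setT !setIT; apply.
- exact: interval_open.
- exact: interval_open.
- exact: interval_is_interval.
- exact: measurable_funM.
- move=> z /gt0J z0; split; first by apply/gt0J; rewrite mulr_gt0.
  by field; rewrite gt_eqF.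
- move=> z /gt0J z0; split; first by apply/gt0J; rewrite divr_gt0.
  by field; rewrite gt_eqF.
- by move=> x y _ _ xy; rewrite ltr_pM2l.
- by move=> z _; exact: cvg_cst.
- by move=> z _; exact: ltW.
- by move=> z /gt0J; exact: h0.
Qed.

(** * Law of the squared ratio of difference and sum *)

(** The factorisation assumed of [f ((1 - u) * z) * f ((1 + u) * z)] separates the variables: after
    both substitutions the double integral splits into an integral in [u], which alone sees [A], and
    a constant integral in [z]. *)
Lemma ratio_sqr_distribution (d : measure_display) (T : measurableType d)
    (R : realType) (P : probability T R) (X Y : {mfun T >-> R}) (f p : R -> R) :
  has_density (distribution P X) f -> has_density (distribution P Y) f ->
  (forall A B, measurable A -> measurable B ->
     P (X @^-1` A `&` Y @^-1` B) = (P (X @^-1` A) * P (Y @^-1` B))%E) ->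
  (forall x, x <= 0 -> f x = 0) -> {in `]0, +oo[%classic, continuous f} ->
  measurable_fun [set: R] p -> {in `]0, 1[%classic, continuous p} ->
  (forall w, 0 <= p w) ->
  (forall u z, -1 < u < 1 -> 0 < z ->
     f ((1 - u) * z) * f ((1 + u) * z) = p (u ^+ 2) * f z ^+ 2) ->
  forall A, measurable A ->
    P ((fun t => ((Y t - X t) / (Y t + X t)) ^+ 2) @^-1` A) =
    (\int[lebesgue_measure]_(w in `](0%R : R), 1%R[ `&` A)
       (p w * (Num.sqrt w)^-1)%:E *
     \int[lebesgue_measure]_(z in `](0%R : R), +oo[)
       (f z ^+ 2 * (2 * z))%:E)%E.
Proof.
move=> fX fY XY f_le0 cf mp cp p0 fp A mA.
have [mf f0 _] := fX.
pose I : set R := `]-1, 1[%classic.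
pose J : set R := `]0, +oo[%classic.
have gt0J (x : R) : J x <-> 0 < x by rewrite /J /= in_itv/= andbT.
pose sqr (x : R) := x ^+ 2.
have msqr : measurable_fun [set: R] sqr by exact: measurable_funX.
have mS : measurable (sqr @^-1` A).
  by rewrite -[X in measurable X]setTI; exact: msqr.
pose S := sqr @^-1` A.
have mIS : measurable (I `&` S) by apply: measurableI => //; exact: measurable_itv.
have mJ : measurable J by exact: measurable_itv.
pose U (x y : R) := (y - x) / (y + x).
pose E := (fun z : R * R => sqr (U z.1 z.2)) @^-1` A.
have mE : measurable E.
  rewrite -[X in measurable X]setTI.
  suff mU : measurable_fun [set: R * R] (fun z : R * R => sqr (U z.1 z.2)) by exact: mU.
  apply: measurableT_comp => //; apply: measurable_funM.
    by apply: measurable_funB; [exact: measurable_snd|exact: measurable_fst].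
  apply: measurable_inv_comp.
  by apply: measurable_funD; [exact: measurable_snd|exact: measurable_fst].
(* The joint density in the coordinates [x = z.1] and [u = z.2], with the Jacobian of the first
   substitution. *)
pose q (z : R * R) :=
  f z.1 * (f (2 * z.1 / (1 - z.2) - z.1) * (2 * z.1 / (1 - z.2) ^+ 2)).
have mq : measurable_fun [set: R * R] q.
  have m1 : measurable_fun [set: R * R] (fun z : R * R => z.1) by exact: measurable_fst.
  have m2 : measurable_fun [set: R * R] (fun z : R * R => 1 - z.2).
    by apply: measurable_funB => //; exact: measurable_snd.
  have m3 : measurable_fun [set: R * R] (fun z : R * R => 2 * z.1).
    exact: measurable_funM.
  apply: measurable_funM; first exact: measurableT_comp.
  apply: measurable_funM.
    apply: measurableT_comp => //; apply: measurable_funB => //.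
    by apply: measurable_funM => //; exact: measurable_inv_comp.
  apply: measurable_funM => //; apply: measurable_inv_comp.
  exact: measurable_funX.
have q0 x u : 0 < x -> 0 <= q (x, u).
  move=> x0; rewrite /q mulr_ge0// mulr_ge0// divr_ge0 ?sqr_ge0//.
  by rewrite mulr_ge0// ltW.
have -> : P ((fun t => ((Y t - X t) / (Y t + X t)) ^+ 2) @^-1` A) =
    (\int[lebesgue_measure]_(x in J) \int[lebesgue_measure]_(u in I `&` S)
       (q (x, u))%:E)%E.
  rewrite [LHS](joint_distribution_density _ _ _ _ _ _ _ _ fX fY XY _ mE).
  rewrite [RHS]integral_mkcond; apply: eq_integral => x _.
  rewrite patchE; case: ifPn => [|/negP xJ]; last first.
    rewrite integral0_eq// => y _; rewrite f_le0 ?mul0r// leNgt.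
    by apply/negP => x0; apply: xJ; rewrite inE; exact/gt0J.
  rewrite inE => /gt0J x0.
  have -> : xsection E x = U x @^-1` S.
    by apply/seteqP; split => y; rewrite /xsection /= inE.
  have mUx : measurable (U x @^-1` S).
    have mU : measurable_fun [set: R] (U x).
      apply: measurable_funM; first exact: measurable_funB.
      by apply: measurable_inv_comp; exact: measurable_funD.
    by rewrite -[X in measurable X]setTI; exact: mU.
  have mJU : measurable (J `&` U x @^-1` S).
    by apply: measurableI => //; exact: measurable_itv.
  (* [f] vanishes on nonpositive arguments, so the section may be cut down to positive [y], where
     the substitution is available. *)
  transitivity (\int[lebesgue_measure]_(y in J `&` U x @^-1` S)
      (f x * f y)%:E)%E.
    rewrite integral_mkcondl; apply: eq_integral => y _; rewrite patchE.
    case: ifPn => // /negP yJ; rewrite (f_le0 y) ?mulr0// leNgt.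
    by apply/negP => y0; apply: yJ; rewrite inE; exact/gt0J.
  under eq_integral do rewrite EFinM.
  rewrite ge0_integralZl//; last 3 first.
  - by apply/measurable_EFinP; exact: measurable_funTS.
  - by move=> y _; rewrite lee_fin.
  - by rewrite lee_fin.
  rewrite (@integral_ratio_substitution _ f x S)//.
  rewrite -ge0_integralZl//; last 3 first.
  - apply/measurable_EFinP/measurable_funTS.
    have m1 : measurable_fun [set: R] (fun u : R => (1 - u)^-1).
      by apply: measurable_inv_comp; exact: measurable_funB.
    apply: measurable_funM.
      apply: measurableT_comp => //; apply: measurable_funB => //.
      exact: measurable_funM.
    apply: measurable_funM => //; apply: measurable_inv_comp.
    by apply: measurable_funX; exact: measurable_funB.
  - move=> u _; rewrite lee_fin mulr_ge0// divr_ge0 ?sqr_ge0//.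
    by rewrite mulr_ge0// ltW.
  - by rewrite lee_fin.
(* With [u] outermost, [x] can be rescaled by the factor [1 - u], which is now fixed. *)
rewrite ge0_fubini_tonelli_setX//; last by move=> x u /gt0J x0 _; exact: q0.
have K0 : (0 <= \int[lebesgue_measure]_(z in J) (f z ^+ 2 * (2 * z))%:E)%E.
  apply: integral_ge0 => z /gt0J z0.
  by rewrite lee_fin mulr_ge0 ?sqr_ge0// mulr_ge0// ltW.
(* Used from right to left: the integral in [w] of the goal becomes one in [u] over []-1, 1[], so
   that the integrands can be compared for each [u]. *)
rewrite -(ge0_integral_substitution_sqr _ _ mp cp p0)//.
rewrite -ge0_integralZr//; last 2 first.
- apply/measurable_EFinP/measurable_funTS.
  exact: (measurableT_comp mp).
- by move=> u _; rewrite lee_fin.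
apply: eq_integral => u; rewrite inE => -[Iu _].
have /andP[u_gtN1 u_lt1] : -1 < u < 1 by rewrite /I /= in_itv/= in Iu.
have u1 : 0 < 1 - u by rewrite subr_gt0.
rewrite (@integral_scale_gt0 _ (1 - u) (fun x => q (x, u)))//; last 2 first.
- move=> x; rewrite inE => /gt0J x0.
  rewrite /q /=.
  apply: cvgM; first by apply: cf; rewrite inE; exact/gt0J.
  apply: cvgM.
    apply: (@cvg_comp _ _ _ (fun y : R => 2 * y / (1 - u) - y) f); last first.
      apply: cf; rewrite inE; apply/gt0J; rewrite subr_gt0 ltr_pdivlMr//.
      (* After clearing the denominator, positivity of the argument of [f] is exactly this
         inequality; stated as a product it leaves a linear goal. *)
      have /= : 0 < x * (1 + u) by rewrite mulr_gt0//; lra.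
      by move=> /= ?; lra.
    apply: cvgB; last exact: cvg_id.
    by apply: cvgM; [apply: cvgM; [exact: cvg_cst|exact: cvg_id]|exact: cvg_cst].
  by apply: cvgM; [apply: cvgM; [exact: cvg_cst|exact: cvg_id]|exact: cvg_cst].
- by move=> x; exact: q0.
rewrite -ge0_integralZl//; last 3 first.
- apply/measurable_EFinP/measurable_funM; last exact: measurable_funM.
  by apply: measurable_funX; exact: measurable_funTS.
- move=> z; rewrite /= in_itv/= andbT => z0.
  by rewrite lee_fin mulr_ge0 ?sqr_ge0// mulr_ge0// ltW.
- by rewrite lee_fin.
apply: eq_integral => z; rewrite inE => /gt0J z0.
rewrite -EFinM /q /=; congr (_%:E).
(* At [x = (1 - u) * z] the second argument of the joint density becomes [(1 + u) * z], and the two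
   Jacobians [2 * x / (1 - u) ^+ 2] and [1 - u] multiply to [2 * z]. *)
have -> : 2 * ((1 - u) * z) / (1 - u) - (1 - u) * z = (1 + u) * z.
  by field; rewrite gt_eqF.
rewrite [RHS]mulrA -fp ?u_gtN1//.
by field; rewrite gt_eqF.
Qed.

(** * The gamma density and samples of size two *)

Lemma gamma_density_continuous (R : realType) (lambda alpha : R) :
  {in `]0, +oo[%classic, continuous (gamma_density lambda alpha)}.
Proof.
apply: (@eq_continuous_open _ _ (fun y : R =>
    (gamma_function alpha * lambda `^ alpha)^-1
      * y `^ (alpha - 1) * expR (- (y / lambda)))).
- exact: interval_open.
- by move=> y; rewrite /= in_itv/= andbT /gamma_density => ->.
move=> x; rewrite inE/= in_itv/= andbT => x0.
apply: cvgM; first apply: cvgM; [exact: cvg_cst|exact: continuous_powR_at|].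
apply: (@cvg_comp _ _ _ (fun y : R => - (y / lambda)) expR); last first.
  exact: continuous_expR.
by apply: cvgN; apply: cvgM; [exact: cvg_id|exact: cvg_cst].
Qed.

(* Both arguments add up to [2 z], so that the exponential factors of the
   product do not depend on [u]. *)
Lemma gamma_densityM (R : realType) (lambda alpha u z : R) :
  -1 < u < 1 -> 0 < z ->
  gamma_density lambda alpha ((1 - u) * z) *
  gamma_density lambda alpha ((1 + u) * z) =
  (1 - u ^+ 2) `^ (alpha - 1) * gamma_density lambda alpha z ^+ 2.
Proof.
move=> /andP[u_gtN1 u_lt1] z0.
have u1 : 0 < 1 - u by rewrite subr_gt0.
have u2 : 0 < 1 + u by lra.
rewrite /gamma_density z0 !mulr_gt0//.
rewrite (powRM _ (ltW u1) (ltW z0)) (powRM _ (ltW u2) (ltW z0)).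
have -> : 1 - u ^+ 2 = (1 - u) * (1 + u) by ring.
rewrite (powRM _ (ltW u1) (ltW u2)).
set c := (gamma_function alpha * lambda `^ alpha)^-1.
have expE : expR (- ((1 - u) * z / lambda)) * expR (- ((1 + u) * z / lambda)) =
    expR (- (z / lambda)) ^+ 2.
  by rewrite expr2 -!expRD; congr expR; ring.
rewrite !exprMn -expE.
by ring.
Qed.

(** For observations [x] and [y] the mean is [(x + y) / 2] and the variance [(y - x) ^+ 2 / 4]. The
    identity holds at every [t]: where [x = y] or [x + y = 0], both sides are 0 because
    [0^-1 = 0]. *)
Lemma inv_moment_estimator2E (d : measure_display) (T : measurableType d)
    (R : realType) (X : 'I_2 -> {mfun T >-> R}) (t : T) :
  inv_mfun (moment_estimator X) t =
  ((X 1 t - X 0 t) / (X 1 t + X 0 t)) ^+ 2.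
Proof.
rewrite [LHS](_ : _ = (sample_mean X t ^+ 2 / sample_variance X t)^-1)//.
rewrite /sample_variance /sample_mean.
rewrite !big_ord_recl !big_ord0 !addr0.
have -> : lift ord0 ord0 = 1 :> 'I_2 by exact/val_inj.
have -> : (ord0 : 'I_2) = 0 by exact/val_inj.
set x := X 0 t; set y := X 1 t.
have -> : ((x - (x + y) / 2) ^+ 2 + (y - (x + y) / 2) ^+ 2) / 2 =
    (y - x) ^+ 2 / 4 by field.
have -> : ((x + y) / 2) ^+ 2 = (y + x) ^+ 2 / 4 by field.
by rewrite !invf_div expr_div_n mulrA divfK.
Qed.

Lemma independent_RVs2 (d : measure_display) (T : measurableType d)
    (R : realType) (P : probability T R) (X : 'I_2 -> {mfun T >-> R}) :
  independent_RVs P X ->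
  forall A B, measurable A -> measurable B ->
    P (X 0 @^-1` A `&` X 1 @^-1` B) = (P (X 0%R @^-1` A) * P (X 1%R @^-1` B))%E.
Proof.
move=> indX A B mA mB.
have := indX [set: 'I_2]%SET (fun i => if i == 0 then A else B).
have -> : \bigcap_(i in [set i | i \in [set: 'I_2]%SET])
    X i @^-1` (if i == 0 then A else B) = X 0 @^-1` A `&` X 1 @^-1` B.
  apply/seteqP; split => t /=.
    by move=> Xt; split; [have := Xt 0|have := Xt 1]; rewrite /= finset.in_setT; exact.
  move=> [At Bt] i _; have [->//|i0] := eqVneq i 0.
  by have -> : i = 1 by case: i i0 => [[|[|//]]] //= ? _; exact/val_inj.
rewrite big_mkcond/= !big_ord_recl big_ord0 !finset.in_setT mule1/=.
have -> : lift ord0 ord0 = 1 :> 'I_2 by exact/val_inj.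
by apply => i; case: ifP.
Qed.

(** * The beta law of the inverse estimator *)

Lemma beta_density_ge0 (R : realType) (a b x : R) : 0 <= beta_density a b x.
Proof.
rewrite /beta_density; case: ifP => // _.
rewrite divr_ge0 ?mulr_ge0 ?powR_ge0//.
by apply: Rintegral_ge0 => y _; rewrite mulr_ge0 ?powR_ge0.
Qed.

Lemma measurable_powR_onem (R : realType) (b : R) :
  measurable_fun [set: R] (fun x : R => (1 - x) `^ b).
Proof.
apply: (measurableT_comp (measurable_powR b)).
exact: measurable_funB.
Qed.

Lemma measurable_beta_density (R : realType) (a b : R) :
  measurable_fun [set: R] (beta_density a b).
Proof.
apply: measurable_fun_ifT => //.
  by apply: measurable_and; exact: measurable_fun_ltr.
apply: measurable_funM => //; apply: measurable_funM.
  exact: measurable_powR.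
exact: measurable_powR_onem.
Qed.

Lemma powR_onem_continuous (R : realType) (b : R) :
  {in `]0, 1[%classic, continuous (fun x : R => (1 - x) `^ b)}.
Proof.
move=> x; rewrite inE/= in_itv/= => /andP[x0 x1].
apply: (@cvg_comp _ _ _ (fun y : R => 1 - y) (fun y : R => y `^ b)); last first.
  by apply: continuous_powR_at; rewrite subr_gt0.
by apply: cvgB; [exact: cvg_cst|exact: cvg_id].
Qed.

(** An infinite factor would make the product 0 or infinite, so both factors are finite and nonzero.
    Applied to a total mass, this yields finiteness and the normalising constant at once. *)
Lemma mule_eq1_fine (R : realType) (x y : \bar R) :
  (0 <= x)%E -> (0 <= y)%E -> (x * y = 1)%E ->
  0 < fine x /\ y = ((fine x)^-1)%:E.
Proof.
move: x y => [x| |] [y| |] //.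
- rewrite !lee_fin => x0 y0 [xy1].
  have x_neq0 : x != 0.
    by apply/eqP => x_eq0; move/eqP: xy1; rewrite x_eq0 mul0r eq_sym oner_eq0.
  split; first by rewrite lt_neqAle eq_sym x_neq0.
  by congr (_%:E); rewrite -[LHS](mulKf x_neq0) xy1 mulr1.
- rewrite lee_fin le_eqVlt => /predU1P[<- _|x0 _].
    by rewrite mul0e => -[/eqP]; rewrite eq_sym oner_eq0.
  by rewrite gt0_muley.
- move=> _; rewrite lee_fin le_eqVlt => /predU1P[<-|y0].
    by rewrite mule0 => -[/eqP]; rewrite eq_sym oner_eq0.
  by rewrite gt0_mulye.
Qed.

Lemma powR_halfB1 (R : realType) (w : R) :
  0 <= w -> w `^ (1 / 2 - 1) = (Num.sqrt w)^-1.
Proof.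
move=> w0; rewrite (_ : 1 / 2 - 1 = - 2^-1 :> R); last by field.
by rewrite powRN powR12_sqrt.
Qed.

Lemma beta_function_half (R : realType) (b : R) :
  beta_function (1 / 2) b =
  fine (\int[lebesgue_measure]_(w in `](0%R : R), 1%R[)
    ((1 - w) `^ (b - 1) * (Num.sqrt w)^-1)%:E)%E.
Proof.
congr fine; apply: eq_integral => w; rewrite inE/= in_itv/= => /andP[w0 _].
by rewrite mulrC powR_halfB1// ltW.
Qed.

(** Positivity of the beta function comes out of the same normalisation and is recorded here,
    because the support and the likelihood ratio of the estimator depend on it. *)
Lemma gamma_sample_inv_moment_estimator (d : measure_display)
    (T : measurableType d) (R : realType) (P : probability T R)
    (lambda alpha : R) (X : 'I_2 -> {mfun T >-> R}) :
  gamma_sample P lambda alpha X ->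
  has_density (distribution P (inv_mfun (moment_estimator X)))
    (beta_density (1 / 2) alpha) /\ 0 < beta_function (1 / 2) alpha.
Proof.
move=> [indX fX].
pose p (w : R) := (1 - w) `^ (alpha - 1).
have mp : measurable_fun [set: R] p by exact: measurable_powR_onem.
have cp : {in `]0, 1[%classic, continuous p} by exact: powR_onem_continuous.
have p0 w : 0 <= p w by exact: powR_ge0.
have f_le0 x : x <= 0 -> gamma_density lambda alpha x = 0.
  by move=> x0; rewrite /gamma_density ltNge x0.
have law := ratio_sqr_distribution _ _ _ _ _ _ _ _ (fX 0) (fX 1)
  (independent_RVs2 _ _ _ _ _ indX) f_le0 (gamma_density_continuous _ _ _)
  mp cp p0 (fun u z => gamma_densityM _ _ _ _ _).
pose b (w : R) := p w * (Num.sqrt w)^-1.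
have b0 w : 0 <= b w by rewrite mulr_ge0// invr_ge0 sqrtr_ge0.
have mb : measurable_fun [set: R] b.
  apply: measurable_funM => //; apply: measurable_inv_comp.
  by apply: continuous_measurable_fun; exact: sqrt_continuous.
pose I := (\int[lebesgue_measure]_(w in `](0%R : R), 1%R[) (b w)%:E)%E.
pose K := (\int[lebesgue_measure]_(z in `](0%R : R), +oo[)
  (gamma_density lambda alpha z ^+ 2 * (2 * z))%:E)%E.
(* The law evaluated on the whole line. It forces the constant [K] to be the inverse of [fine I],
   which is the beta function at [1 / 2] and [alpha]. *)
have IK : (I * K = 1)%E.
  by have := law setT measurableT; rewrite preimage_setT probability_setT setIT.
have I_ge0 : (0 <= I)%E.
  by apply: integral_ge0 => w _; rewrite lee_fin.
have K_ge0 : (0 <= K)%E.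
  apply: integral_ge0 => z; rewrite /= in_itv/= andbT => z0.
  by rewrite lee_fin mulr_ge0 ?sqr_ge0// mulr_ge0// ltW.
have [I_gt0 KE] := mule_eq1_fine _ _ _ I_ge0 K_ge0 IK.
rewrite beta_function_half -/I; split => //; split.
- exact: measurable_beta_density.
- by move=> x; exact: beta_density_ge0.
move=> A mA.
have -> : distribution P (inv_mfun (moment_estimator X)) A =
    P ((fun t => ((X 1 t - X 0 t) / (X 1 t + X 0 t)) ^+ 2) @^-1` A).
  congr (P _); apply/seteqP.
  by split => t; rewrite /= -inv_moment_estimator2E.
have m01A : measurable (`]0, 1[%classic `&` A : set R).
  by apply: measurableI => //; exact: measurable_itv.
rewrite law// -/K KE -ge0_integralZr//; last 3 first.
- by apply/measurable_EFinP; exact: measurable_funTS.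
- by move=> w _; rewrite lee_fin b0.
- by rewrite lee_fin invr_ge0 ltW.
rewrite integral_mkcondl; apply: eq_integral => w _; rewrite patchE.
rewrite /beta_density; case: ifPn => w01.
  have {}w01 : 0 < w < 1 by rewrite inE/= in_itv/= in w01.
  have /andP[w0 _] := w01.
  by rewrite w01 beta_function_half -/I -EFinM powR_halfB1 ?ltW//;
    congr (_ / _)%:E; exact: mulrC.
rewrite ifF//; apply/negbTE; apply: contra w01 => w01.
by rewrite inE/= in_itv.
Qed.

Lemma beta_density_continuous (R : realType) (a b : R) :
  {in `]0, 1[%classic, continuous (beta_density a b)}.
Proof.
apply: (@eq_continuous_open _ _ (fun y : R =>
    y `^ (a - 1) * (1 - y) `^ (b - 1) / beta_function a b)).
- exact: interval_open.
- by move=> y; rewrite /= in_itv/= /beta_density => ->.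
move=> x x01; apply: cvgM; last exact: cvg_cst.
apply: cvgM; last exact: powR_onem_continuous.
by apply: continuous_powR_at; move: x01; rewrite inE/= in_itv/= => /andP[].
Qed.

(** * Density of the estimator and monotonicity of the likelihood ratio *)

(** Inversion is a decreasing bijection from []1, +oo[] onto []0, 1[], and [x ^- 2] is the absolute
    value of its derivative. *)
Lemma has_density_inv_beta (R : realType) (nu : set R -> \bar R) (a b : R) :
  has_density nu (beta_density a b) ->
  has_density (fun A => nu (GRing.inv @^-1` A))
    (fun x => beta_density a b x^-1 * x ^- 2).
Proof.
move=> [mbeta _ nuE].
have minv : measurable_fun [set: R] (@GRing.inv R) by exact: measurable_inv_comp.
split.
- apply: measurable_funM; first exact: measurableT_comp.
  by apply: measurable_inv_comp; exact: measurable_funX.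
- by move=> x; rewrite mulr_ge0 ?beta_density_ge0// invr_ge0 sqr_ge0.
move=> A mA.
have mAinv : measurable (GRing.inv @^-1` A : set R).
  by rewrite -[X in measurable X]setTI; exact: minv.
rewrite nuE//.
pose I : set R := `]1, +oo[%classic.
pose J : set R := `]0, 1[%classic.
have gt1I (x : R) : I x <-> 1 < x by rewrite /I /= in_itv/= andbT.
have JP (y : R) : J y <-> 0 < y < 1 by rewrite /J /= in_itv/=.
have oI : open I by exact: interval_open.
have oJ : open J by exact: interval_open.
have iJ : is_interval J by exact: interval_is_interval.
pose f (x : R) : R := x ^- 2.
have dF (x : R) : I x -> is_derive x (1 : R) GRing.inv (- f x).
  move=> /gt1I x1; have x0 : x != 0 by rewrite gt_eqF// (lt_trans _ x1).
  apply: (is_derive_eq (@is_deriveV R id x 1 1 x0 (is_derive_id x 1))).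
  by rewrite /GRing.scale/= mulr1.
transitivity (\int[lebesgue_measure]_(y in J `&` GRing.inv @^-1` A)
    (beta_density a b y)%:E)%E.
  rewrite integral_mkcondl; apply: eq_integral => y _; rewrite patchE.
  case: ifPn => // yJ; rewrite /beta_density ifF//.
  by apply/negbTE; apply: contra yJ => y01; rewrite inE; exact/JP.
transitivity (\int[lebesgue_measure]_(x in I `&` A)
    (beta_density a b x^-1 * f x)%:E)%E.
  apply: (@ge0_integral_substitution_decreasing R I J GRing.inv GRing.inv f) => //.
  - move=> x /gt1I x1; rewrite invrK; split => //; apply/JP.
    by rewrite invr_gt0 invf_lt1 ?x1 ?(lt_trans _ x1).
  - move=> y /JP/andP[y0 y1]; rewrite invrK; split => //; apply/gt1I.
    by rewrite invf_gt1.
  - move=> x y; rewrite !inE => /gt1I x1 /gt1I y1 xy.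
    by rewrite ltf_pV2// posrE (lt_trans _ x1, lt_trans _ y1).
  - move=> x; rewrite inE => /gt1I x1.
    apply: cvgV; first by rewrite gt_eqF// exprn_gt0// (lt_trans _ x1).
    exact: exprn_continuous.
  - by move=> x _; rewrite invr_ge0 sqr_ge0.
  - exact: beta_density_continuous.
  - by move=> y _; exact: beta_density_ge0.
(* For [x <= 1] the inverse lies outside []0, 1[], also at [x = 0] where it is 0, so the density
   vanishes there. *)
rewrite integral_mkcondl; apply: eq_integral => x _; rewrite patchE.
case: ifPn => // xI; rewrite /beta_density ifF ?mul0r//.
apply/negbTE; apply: contra xI => /andP[x0 x1]; rewrite inE; apply/gt1I.
by rewrite invr_gt0 in x0; rewrite invf_lt1 in x1.
Qed.

Lemma beta_density_likelihood_ratio (R : realType) (a b1 b2 v : R) :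
  0 < v < 1 -> 0 < beta_function a b1 -> 0 < beta_function a b2 ->
  beta_density a b2 v / beta_density a b1 v =
  (1 - v) `^ (b2 - b1) * (beta_function a b1 / beta_function a b2).
Proof.
move=> v01 B1 B2; have /andP[v0 v1] := v01.
have onem_v : 0 < 1 - v by rewrite subr_gt0.
rewrite /beta_density v01.
have -> : b2 - 1 = (b2 - b1) + (b1 - 1) by ring.
rewrite (@powRD _ (1 - v)); last by apply/implyP => _; rewrite gt_eqF.
have p1 : v `^ (a - 1) != 0 by rewrite gt_eqF// powR_gt0.
have p2 : (1 - v) `^ (b1 - 1) != 0 by rewrite gt_eqF// powR_gt0.
(* The powers are abstracted to nonzero unknowns, which leaves a rational identity for [field]. *)
move: (v `^ (a - 1)) ((1 - v) `^ (b1 - 1)) ((1 - v) `^ (b2 - b1)) p1 p2.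
move: (beta_function a b1) (beta_function a b2) B1 B2 => B1 B2 B1_gt0 B2_gt0.
by move=> p1 p2 p3 p1_neq0 p2_neq0; field; rewrite p2_neq0 ?p1_neq0 !gt_eqF.
Qed.

Theorem corollary2 (R : realType) (lambda : R) (lambda_gt0 : 0 < lambda) :
  (forall (d : measure_display) (T : measurableType d) (P : probability T R)
     (alpha : R) (X : 'I_2 -> {RV P >-> R}),
     0 < alpha ->
     gamma_sample P lambda alpha X ->
     has_density (distribution P (inv_mfun (moment_estimator X)))
       (beta_density (1 / 2) alpha)) /\
  (forall (d : measure_display) (T : measurableType d)
     (P : R -> probability T R) (X : 'I_2 -> {mfun T >-> R}),
     (forall alpha : R, 0 < alpha ->
        gamma_sample (P alpha) lambda alpha X) ->
     monotone_likelihood_ratio [set alpha : R | 0 < alpha]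
       (fun alpha => distribution (P alpha) (moment_estimator X))).
Proof.
split=> [d T P alpha X _ gammaX|d T P X gammaX].
  exact: (gamma_sample_inv_moment_estimator _ _ _ _ _ _ _ gammaX).1.
(* The beta density is positive exactly on []0, 1[], so the density of the estimator is positive
   exactly on []1, +oo[], whatever the parameter. *)
pose D : set R := [set x | 1 < x].
pose f (theta x : R) : R := beta_density (1 / 2) theta x^-1 * x ^- 2.
have inv01 (x : R) : (0 < x^-1 < 1) = (1 < x).
  apply/idP/idP => [/andP[x0 x1]|x1].
    by rewrite invr_gt0 in x0; rewrite invf_lt1 in x1.
  by rewrite invr_gt0 invf_lt1 ?x1 ?(lt_trans _ x1).
have B_gt0 (theta : R) : 0 < theta -> 0 < beta_function (1 / 2) theta.
  by move=> /gammaX /gamma_sample_inv_moment_estimator[].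
exists f, D; split=> [theta theta0|theta theta0|theta1 theta2].
- have [fX _] := gamma_sample_inv_moment_estimator _ _ _ _ _ _ _ (gammaX _ theta0).
  have [mf f0 fE] := has_density_inv_beta _ _ _ _ fX.
  split => // A mA; rewrite -fE//; congr (P theta _).
  by apply/seteqP; split => t; rewrite /= /inv_mfun /= invrK.
- apply/seteqP; split => x /=; rewrite /f /beta_density inv01.
    by case: ifP => //; rewrite mul0r ltxx.
  rewrite /D /= => x1; rewrite x1.
  have x0 : 0 < x by exact: lt_trans x1.
  have onem_x : 0 < 1 - x^-1 by rewrite subr_gt0 invf_lt1.
  rewrite mulr_gt0// ?invr_gt0 ?exprn_gt0// divr_gt0 ?B_gt0//.
  by rewrite mulr_gt0// powR_gt0// invr_gt0.
- move=> theta1_gt0 theta2_gt0 theta12 x y Dx Dy xy.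
  have fE z : D z -> f theta2 z / f theta1 z = (1 - z^-1) `^ (theta2 - theta1)
      * (beta_function (1 / 2) theta1 / beta_function (1 / 2) theta2).
    move=> Dz; rewrite -beta_density_likelihood_ratio ?B_gt0 ?inv01//.
    (* The Jacobian factor is the same for both parameters and cancels, leaving the ratio of beta
       densities at [z^-1]. *)
    have z0 : z ^- 2 != 0.
      by rewrite invr_eq0 expf_neq0// gt_eqF// (lt_trans _ Dz).
    by rewrite /f -mulf_div divff// mulr1.
  have x0 : 0 < x by exact: lt_trans Dx.
  have y0 : 0 < y by exact: lt_trans Dy.
  (* What remains is a nonnegative power of [1 - z^-1], which is nonnegative and increasing in [z]
     on [D]. *)
  rewrite !fE// ler_wpM2r//; first by rewrite divr_ge0// ltW// B_gt0.
  apply: ge0_ler_powR; first by rewrite subr_ge0 ltW.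
  + by rewrite nnegrE subr_ge0 invf_le1// ltW.
  + by rewrite nnegrE subr_ge0 invf_le1// ltW.
  + by rewrite lerB// lef_pV2.
Qed.
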